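(* Let $G=(V,E)$ be a connected, locally finite graph, and let $0<p<1$. The inequality $$\mathbb{P}_p\left(|E(K_v)|\leq m\text{ and }\tau(K_v,K_\infty)\geq n\right)\leq 2\exp\left[-\frac{p^2n^2}{8m}\right]$$ holds for every $v\in V$ and $n,m\geq 1$.
   Context: Bernoulli bond percolation: $G_p$ is the random subgraph of $G$ in which each edge is independently open (retained) with probability $p$ and closed (deleted) otherwise, with law $\mathbb{P}_p$; clusters are the connected components of $G_p$. $K_v$ is the cluster of $v$ in $G_p$, $K_\infty$ is the union of all infinite clusters of $G_p$, $E(K_v)$ is the set of edges of $G$ that touch $K_v$ (have at least one endpoint in the vertex set of $K_v$), and $\tau(A,B)$ is the number of edges of $G$ with one endpoint in $A$ and the other in $B$. *)

(* Defs.v *)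
From HB Require Import structures.
From mathcomp Require Import all_boot all_order all_algebra finmap.
From mathcomp Require Import all_classical all_reals all_analysis.

Set Implicit Arguments.
Unset Strict Implicit.
Unset Printing Implicit Defensive.

Import Order.TTheory GRing.Theory Num.Theory.

Local Open Scope classical_set_scope.
Local Open Scope ring_scope.

(* Loops and parallel edges are allowed, and V and E may be infinite. The
   graph is undirected: which end of an edge is called [src] is arbitrary, and
   all the notions below are symmetric in [src] and [tgt]. *)
Record multigraph (V E : choiceType) := Multigraph {
  src : E -> V;
  tgt : E -> V
}.

Section Graphs.
Context (V E : choiceType) (G : multigraph V E).

Definition joins (e : E) (x y : V) : Prop :=
  (src G e = x /\ tgt G e = y) \/ (src G e = y /\ tgt G e = x).

(* Subgraphs with full vertex set V are encoded by their set O of edges. *)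
Definition adjacent (O : set E) (x y : V) : Prop :=
  exists2 e, O e & joins e x y.

Definition linked (O : set E) (x y : V) : Prop :=
  exists s : seq V, path (fun a b => `[< adjacent O a b >]) x s /\ last x s = y.

Definition touching (A : set V) : set E :=
  [set e | A (src G e) \/ A (tgt G e)].

Definition edges_between (A B : set V) : set E :=
  [set e | exists x y, [/\ A x, B y & joins e x y]].

Definition graph_connected : Prop := forall x y, linked setT x y.

Definition locally_finite : Prop := forall x, finite_set (touching [set x]).

Definition bond_cluster (O : set E) (v : V) : set V := [set u | linked O v u].

Definition infinite_clusters (O : set E) : set V :=
  \bigcup_(u in [set u | infinite_set (bond_cluster O u)]) bond_cluster O u.

End Graphs.

Section Percolation.
Context (d : measure_display) (T : measurableType d) (R : realType).
Context (P : probability T R).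

Definition mutually_independent (I : choiceType) (X : I -> {RV P >-> bool}) :
    Prop :=
  forall (J : {fset I}) (B : I -> set bool),
    P (\bigcap_(i in [set` J]) (X i @^-1` B i)) =
    (\prod_(i <- J) P (X i @^-1` B i))%E.

(* [X e] is the indicator of the event that the edge e is open. Every subset
   of bool is measurable, so [mutually_independent] needs no restriction on
   the sets B i. *)
Definition bernoulli_percolation (E : choiceType) (p : R)
    (X : E -> {RV P >-> bool}) : Prop :=
  mutually_independent X /\
  forall e, distribution P (X e) = bernoulli_prob p :> (set bool -> \bar R).

Definition open_edges (E : choiceType) (X : E -> {RV P >-> bool}) (w : T) :
    set E :=
  [set e | X e w].

End Percolation.

(* Main.v *)
Require Import Defs.
From mathcomp Require Import all_boot all_order all_algebra.
From mathcomp Require Import all_classical all_reals all_analysis.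
From mathcomp Require Import finmap ring lra.

Set Implicit Arguments.
Unset Strict Implicit.
Unset Printing Implicit Defensive.

Import Order.TTheory GRing.Theory Num.Theory.

Local Open Scope classical_set_scope.
Local Open Scope card_scope.
Local Open Scope ring_scope.

(** Write [K] for the cluster of [v] and count every closed edge as [p] and
    every open edge as [-(1 - p)], so that each edge has mean zero. Exploring
    [K] edge by edge makes the total count over the edges touching [K] the
    final value of a martingale with bounded increments. Hence the probability
    that at most [m] edges touch [K] and that this total is at least [p n / 2]
    is at most [exp (- p^2 n^2 / (8 m))], and likewise for [- p n / 2].

    The trick, in the style of Aizenman, Kesten and Newman, is to explore in a
    second order: first all the infinite clusters, then [K] in what remains.
    The edges of [K] examined in this second exploration are those that do not
    touch an infinite cluster, and their total count obeys the same bounds.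
    When [K] is finite, the edges between [K] and the infinite clusters are all
    closed; there are at least [n] of them and each contributes [p] to the
    first total and nothing to the second. The two totals thus differ by at
    least [p n], so the first is at least [p n / 2] or the second is at most
    [- p n / 2]. The union bound gives the factor 2.

    Two devices make this rigorous without constructing any exploration.

    - Everything is read off a finite set [S] of edges. A cluster touching at
      most [m] edges lies in the ball [B] of radius [m] around [v]
      ([small_cluster_in_ball]). With [S] the edges touching [B], the role of
      the infinite clusters is played by the clusters, inside [S], of the
      complement of [B]: an infinite cluster has to leave the finite set [B],
      and the part of a path before its first exit uses edges of [S] only
      ([linked_exit]).

    - An exploration is represented by the random set [D] of edges that it
      examines, which is a stopping set: a configuration agreeing with [w] on
      [D w] has the same [D]. Outside of a stopping set the law of the edges
      may be replaced by any other one ([resample_sum]); used twice, this shows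
      that the likelihood ratio of a tilted Bernoulli law, multiplied over
      [D2 w] minus [D1 w], has expectation 1 ([tilted_sum]). This is the
      exponential martingale, and Markov's inequality yields [excess_tail]. The
      two explorations are the pairs (empty set, [D]) and ([D'], [D'] union
      [D]), where [D] and [D'] are the edges touching [K] and those touching
      the clusters of the complement of [B] ([common_closed_edges_bound]).

    The event has to be shown measurable as well: connectedness and local
    finiteness make the graph countable, and the event is a countable
    combination of events about single edges ([measurable_cluster_event]). *)

(** * Stopping sets of edges and change of measure *)

Section Stopping.
Context (R : realType) (I : finType).
Implicit Types (w : {ffun I -> bool}) (D : {ffun I -> bool} -> {set I}).

Definition determined_on D (A : Type) (F : {ffun I -> bool} -> A) :=
  forall w w', {in D w, w =1 w'} -> F w' = F w.

(** The discrete analogue of a stopping time: whether exploration ends with the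
    set [D w] is decided by the states of the edges in [D w]. *)
Definition stopping D := determined_on D D.

Lemma stoppingU D D' :
  stopping D -> stopping D' -> stopping (fun w => D w :|: D' w).
Proof.
move=> sD sD' w w' ww'; congr (_ :|: _).
  by apply: sD => i iD; apply: ww'; rewrite inE iD.
by apply: sD' => i iD; apply: ww'; rewrite inE iD orbT.
Qed.

Lemma prod_ffun_sum (f : I -> bool -> R) :
  \sum_(w : {ffun I -> bool}) \prod_i f i (w i) =
  \prod_i (f i true + f i false).
Proof.
rewrite -(bigA_distr_bigA f); apply: eq_bigr => i _.
by rewrite big_bool.
Qed.

(** Conditionally on the edges of a stopping set, the other edges are
    independent of them and their law can be changed freely. The proof couples
    a configuration drawn with [f] outside of [D] and one drawn with [g]: sum
    over the pairs agreeing on [D], a relation that is symmetric because [D] is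
    stopping. *)
Lemma resample_sum D (F : {ffun I -> bool} -> R) (f g : bool -> R) :
    stopping D -> determined_on D F ->
    f true + f false = 1 -> g true + g false = 1 ->
  \sum_(w : {ffun I -> bool}) F w * \prod_(i in ~: D w) f (w i) =
  \sum_(w : {ffun I -> bool}) F w * \prod_(i in ~: D w) g (w i).
Proof.
move=> sD dF f1 g1.
pose agree w w' := [forall (i | i \in D w), w i == w' i].
have agreeP w w' : reflect {in D w, w =1 w'} (agree w w').
  apply: (iffP forall_inP) => h i /h; first by move/eqP.
  by move=> ->.
have agreeC w w' : agree w w' = agree w' w.
  by apply/idP/idP => /agreeP h; apply/agreeP; rewrite (sD _ _ h) => i /h.
have completions (h : bool -> R) : h true + h false = 1 -> forall w,
    \sum_(w' | agree w w') \prod_(i in ~: D w) h (w' i) = 1.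
  move=> h1 w.
  pose k i b := if i \in D w then (b == w i)%:R else h b.
  transitivity (\prod_i (k i true + k i false)); last first.
    rewrite big1 // => i _; rewrite /k; case: ifP => // _.
    by case: (w i); rewrite !eqE /= ?mulr0n ?addr0 ?add0r ?mulr1n.
  rewrite -prod_ffun_sum [LHS]big_mkcond; apply: eq_bigr => w' _.
  rewrite [RHS](bigID (mem (D w))) /= mulrC.
  rewrite [LHS](_ : _ =
      if agree w w' then \prod_(i | i \notin D w) h (w' i) else 0);
    last by congr (if _ then _ else _); apply: eq_bigl => i; rewrite inE.
  case: ifPn => [/agreeP ww'|].
    rewrite [X in _ * X]big1 ?mulr1; last first.
      by move=> i iD; rewrite /k iD ww' // eqxx.
    by apply: eq_bigr => i /negPf iD; rewrite /k iD.
  rewrite negb_forall => /existsP[i]; rewrite negb_imply => /andP[iD neq].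
  rewrite [X in _ * X](bigD1 i) //= /k iD eq_sym (negPf neq) mul0r mulr0.
  by [].
transitivity (\sum_(w : {ffun I -> bool}) \sum_(w' | agree w w')
   F w * \prod_(i in ~: D w) f (w i) * \prod_(i in ~: D w) g (w' i)).
  by apply: eq_bigr => w _; rewrite -mulr_sumr completions // mulr1.
transitivity (\sum_w \sum_(w' | agree w w')
   F w * \prod_(i in ~: D w) g (w i) * \prod_(i in ~: D w) f (w' i)).
  rewrite (exchange_big_dep xpredT) //=; apply: eq_bigr => w' _.
  rewrite (eq_bigl _ _ (agreeC^~ w')); apply: eq_bigr => w /agreeP h.
  by rewrite (sD _ _ h) (dF _ _ h) mulrAC.
by apply: eq_bigr => w _; rewrite -mulr_sumr completions // mulr1.
Qed.

(** Here [g b = f b * r b] is another law of one edge, and the sum is the total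
    mass of the process that explores [D1] with law [f], then [D2] with law
    [g], and draws the remaining edges with law [f]. [resample_sum] for [D2]
    turns the last of these laws into [g], and then for [D1] turns [g] back
    into [f], leaving a product law. *)
Lemma tilted_sum D1 D2 (f r : bool -> R) :
    stopping D1 -> stopping D2 -> (forall w, D1 w \subset D2 w) ->
    f true + f false = 1 -> f true * r true + f false * r false = 1 ->
  \sum_(w : {ffun I -> bool})
    (\prod_i f (w i)) * \prod_(i in D2 w :\: D1 w) r (w i) = 1.
Proof.
move=> s1 s2 s12 f1 r1.
pose g b := f b * r b.
pose F w := (\prod_(i in D1 w) f (w i)) * \prod_(i in D2 w :\: D1 w) g (w i).
have dF : determined_on D2 F.
  move=> w w' ww'; rewrite /F (s2 _ _ ww') (s1 w w'); last first.
    by move=> i iD; apply: ww'; apply: (fintype.subsetP (s12 w)).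
  congr (_ * _); apply: eq_bigr => i iD; rewrite ww' //.
    exact: (fintype.subsetP (s12 w)).
  by move: iD; rewrite inE => /andP[].
have split_at (A : {set I}) (h : I -> R) :
    \prod_i h i = (\prod_(i in A) h i) * \prod_(i in ~: A) h i.
  rewrite (bigID (mem A)) /=; congr (_ * _).
  by apply: eq_bigl => i; rewrite inE.
have splitC w (h : I -> R) : \prod_(i in ~: D1 w) h i =
    (\prod_(i in D2 w :\: D1 w) h i) * \prod_(i in ~: D2 w) h i.
  rewrite (bigID (mem (D2 w))) /=; congr (_ * _); apply: eq_bigl => i.
    by rewrite !inE.
  rewrite !inE; case: (boolP (i \in D1 w)) => //= iD.
  by rewrite (fintype.subsetP (s12 w) _ iD).
transitivity (\sum_(w : {ffun I -> bool}) F w * \prod_(i in ~: D2 w) f (w i)).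
  apply: eq_bigr => w _; rewrite (split_at (D1 w)) splitC /F big_split /=.
  by rewrite /g; ring.
rewrite (resample_sum s2 dF f1 (g := g)) //.
transitivity (\sum_(w : {ffun I -> bool})
    (\prod_(i in D1 w) f (w i)) * \prod_(i in ~: D1 w) g (w i)).
  by apply: eq_bigr => w _; rewrite splitC mulrA.
rewrite (resample_sum s1 _ (g := f)) //; last first.
  by move=> w w' h; rewrite (s1 _ _ h); apply: eq_bigr => i iD; rewrite h.
transitivity (\sum_(w : {ffun I -> bool}) \prod_i f (w i)).
  by apply: eq_bigr => w _; rewrite (split_at (D1 w)).
by rewrite (prod_ffun_sum (fun=> f)) big1.
Qed.

End Stopping.

(** * Exponential tails for the excess of closed edges *)

(** Follows from [exp x <= (1 - x)^-1] because
    [(1 - x) (1 + x + 2 x^2) = 1 + x^2 (1 - 2 x)] is at least 1. *)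
Lemma expR_le_quadratic (R : realType) (x : R) :
  x <= 2^-1 -> expR x <= 1 + x + 2 * x ^+ 2.
Proof.
move=> hx.
have y0 : 0 < expR (- x) by exact: expR_gt0.
have := expR_ge1Dx (- x).
have : expR x * expR (- x) = 1 by rewrite -expRD subrr expR0.
set y := expR (- x) in y0 *; set z := expR x => zy hy.
have q0 : 0 <= 1 + x + 2 * x ^+ 2 by nra.
have : 1 <= (1 + x + 2 * x ^+ 2) * y.
  have h1 : (1 + x + 2 * x ^+ 2) * (1 - x) <= (1 + x + 2 * x ^+ 2) * y.
    by apply: ler_wpM2l.
  apply: le_trans h1.
  have -> : (1 + x + 2 * x ^+ 2) * (1 - x) = 1 + x ^+ 2 * (1 - 2 * x) by ring.
  by rewrite lerDl mulr_ge0 ?sqr_ge0 //; lra.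
by rewrite -zy ler_pM2r.
Qed.

Section Tail.
Context (R : realType) (p : R) (p_ge0 : 0 <= p) (p_le1 : p <= 1).

(** A closed edge contributes [p] and an open edge [-(1 - p)], which has mean 0
    when edges are open with probability [p]. *)
Definition closed_excess (b : bool) : R := (~~ b)%:R - (1 - p).

(** The quadratic bound on the exponential gives [1 + 2 l^2 Var], and a
    Bernoulli variance is at most 1/4. *)
Lemma bernoulli_mgf (l : R) : `|l| <= 2^-1 ->
  p * expR (l * closed_excess true) + (1 - p) * expR (l * closed_excess false)
  <= expR (l ^+ 2 / 2).
Proof.
rewrite ler_norml => /andP[l1 l2].
have p0 := p_ge0; have q0 : 0 <= 1 - p by rewrite subr_ge0.
rewrite /closed_excess /= !mulr0n mulr1n sub0r opprB.
have ha : expR (l * (p - 1)) <= 1 + l * (p - 1) + 2 * (l * (p - 1)) ^+ 2.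
  apply: expR_le_quadratic.
  have : 0 <= (l + 2^-1) * (1 - p) by apply: mulr_ge0; lra.
  by lra.
have hb : expR (l * (1 + (p - 1))) <= 1 + l * p + 2 * (l * p) ^+ 2.
  rewrite subrKC.
  apply: expR_le_quadratic.
  have : 0 <= (2^-1 - l) * p by apply: mulr_ge0; lra.
  by lra.
apply: le_trans (expR_ge1Dx _).
apply: le_trans (lerD (ler_wpM2l p_ge0 ha) (ler_wpM2l q0 hb)) _.
have l0 : 0 <= l ^+ 2 by exact: sqr_ge0.
have hp : p * (1 - p) <= 4^-1.
  have : 0 <= (p - 2^-1) ^+ 2 by exact: sqr_ge0.
  by nra.
have -> : p * (1 + l * (p - 1) + 2 * (l * (p - 1)) ^+ 2) +
   (1 - p) * (1 + l * p + 2 * (l * p) ^+ 2) = 1 + 2 * (l ^+ 2 * (p * (1 - p))).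
  by ring.
have : l ^+ 2 * (p * (1 - p)) <= l ^+ 2 * 4^-1 by exact: ler_wpM2l.
by lra.
Qed.

Context (I : finType).
Implicit Types (w : {ffun I -> bool}) (D : {ffun I -> bool} -> {set I}).

Definition config_weight w : R := \prod_i bernoulli_pmf p (w i).

Lemma config_weight_ge0 w : 0 <= config_weight w.
Proof.
by apply: prodr_ge0 => i _; apply: bernoulli_pmf_ge0; rewrite p_ge0.
Qed.

(** Markov's inequality for the density of [tilted_sum] with exponential tilt
    [l]: on the event in question that density is at least
    [exp (s - m l^2 / 2)], because its normalising constant is at most
    [exp (l^2 / 2)] for each of the at most [m] edges. *)
Lemma excess_tail D1 D2 (l s : R) (m : nat) :
    stopping D1 -> stopping D2 -> (forall w, D1 w \subset D2 w) ->
    `|l| <= 2^-1 ->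
  \sum_(w | (#|D2 w :\: D1 w| <= m)%N &&
       (s <= l * \sum_(i in D2 w :\: D1 w) closed_excess (w i)))
    config_weight w <= expR (l ^+ 2 / 2 * m%:R - s).
Proof.
move=> s1 s2 s12 hl.
pose phi := p * expR (l * closed_excess true) +
            (1 - p) * expR (l * closed_excess false).
have q0 : 0 <= 1 - p by rewrite subr_ge0.
have phi_gt0 : 0 < phi.
  have := expR_gt0 (l * closed_excess true).
  have := expR_gt0 (l * closed_excess false).
  rewrite /phi; set a := expR _; set b := expR _ => a0 b0.
  have [p0|p0] := eqVneq p 0; first by rewrite p0; lra.
  apply: ltr_wpDr; first by apply: mulr_ge0; lra.
  by rewrite mulr_gt0 // lt0r p0.
pose r b := expR (l * closed_excess b) / phi.
have r_gt0 b : 0 < r b by rewrite divr_gt0 ?expR_gt0.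
have <- : \sum_(w : {ffun I -> bool})
   (config_weight w * \prod_(i in D2 w :\: D1 w) r (w i)) *
                 expR (l ^+ 2 / 2 * m%:R - s) = expR (l ^+ 2 / 2 * m%:R - s).
  rewrite -mulr_suml tilted_sum ?mul1r //.
    by rewrite /bernoulli_pmf; ring.
  rewrite /bernoulli_pmf /r !mulrA -mulrDl -/phi divff //.
  by rewrite gt_eqF.
rewrite big_mkcond /=; apply: ler_sum => w _.
have W0 := config_weight_ge0 w.
case: ifP => [/andP[cm hs]|_]; last first.
  apply: mulr_ge0; last exact: expR_ge0.
  by apply: mulr_ge0 => //; apply: prodr_ge0 => i _; exact: ltW.
rewrite -mulrA ler_peMr // big_split /= -expR_sum -mulr_sumr.
set S := \sum_(i in _) _ in hs *; set A := _ :\: _ in cm hs *.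
have -> : \prod_(i in A) phi^-1 = phi^-1 ^+ #|A| by rewrite prodr_const.
have phiA : phi ^+ #|A| <= expR (l ^+ 2 / 2 * m%:R).
  apply: (@le_trans _ _ (expR (l ^+ 2 / 2) ^+ #|A|)).
    by apply: lerXn2r; rewrite ?nnegrE ?expR_ge0 ?(ltW phi_gt0) // bernoulli_mgf.
  rewrite -expRM_natr ler_expR.
  by rewrite ler_wpM2l ?divr_ge0 ?sqr_ge0 // ler_nat.
rewrite exprVn mulrAC -expRD ler_pdivlMr ?exprn_gt0 // mul1r.
by apply: le_trans phiA _; rewrite ler_expR; lra.
Qed.

(** The excess over [D] exceeds the excess over [D] minus [D'] by [p] for each
    of the at least [n] common edges, all of them closed, so either the former
    is at least [p n / 2] or the latter is at most [- p n / 2]. *)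
Lemma common_closed_edges_bound D D' (n m : nat) :
    stopping D -> stopping D' -> (n <= m)%N -> (0 < m)%N ->
  \sum_(w | [&& (#|D w| <= m)%N, (n <= #|D w :&: D' w|)%N &
             [forall (i | i \in D w :&: D' w), ~~ w i]])
    config_weight w <= 2 * expR (- (p ^+ 2 * n%:R ^+ 2 / (8 * m%:R))).
Proof.
move=> sD sD' nm m0.
have m0' : 0 < m%:R :> R by rewrite ltr0n.
(* [l] minimises [m l^2 / 2 - l p n / 2]; it is at most 1/2 as [n <= m]. *)
pose l : R := p * n%:R / (2 * m%:R).
pose s : R := p ^+ 2 * n%:R ^+ 2 / (4 * m%:R).
have l_ge0 : 0 <= l by rewrite /l !mulr_ge0 ?invr_ge0 ?mulr_ge0.
have l_le : `|l| <= 2^-1.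
  rewrite ger0_norm // /l ler_pdivrMr ?mulr_gt0 //.
  rewrite mulKf // -[m%:R]mul1r.
  by apply: ler_pM => //; rewrite ler_nat.
have expo : l ^+ 2 / 2 * m%:R - s = - (p ^+ 2 * n%:R ^+ 2 / (8 * m%:R)).
  by rewrite /l /s; field; rewrite gt_eqF.
have lNexpo : (- l) ^+ 2 / 2 * m%:R - s = l ^+ 2 / 2 * m%:R - s by rewrite sqrrN.
have s0 : stopping (fun _ : {ffun I -> bool} => finset.set0 : {set I}) by [].
have sU := stoppingU sD' sD.
have T1 := @excess_tail _ _ l s m s0 sD (fun w => finset.sub0set _) l_le.
have T2 := @excess_tail _ _ (- l) s m sD' sU (fun w => finset.subsetUl _ _).
rewrite normrN lNexpo in T2; have {}T2 := T2 l_le.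
rewrite -expo mulr_natl mulr2n; apply: le_trans (lerD T1 T2).
rewrite [X in _ <= X + _]big_mkcond [X in _ <= _ + X]big_mkcond /= -big_split /=.
rewrite big_mkcond /=; apply: ler_sum => w _.
have W0 := config_weight_ge0 w.
have -> : D w :\: finset.set0 = D w by rewrite finset.setD0.
have -> : (D' w :|: D w) :\: D' w = D w :\: D' w.
  by rewrite finset.setDUl finset.setDv finset.set0U.
case: ifPn => [/and3P[cm cn /forall_inP cl]|_]; last first.
  by apply: addr_ge0; case: ifP.
rewrite cm (leq_trans (subset_leq_card (finset.subsetDl _ _)) cm) /=.
set h := \sum_(i in D w) _; set h' := \sum_(i in _ :\: _) _.
have hh' : h = h' + p * #|D w :&: D' w|%:R.
  rewrite /h (big_setID (D' w)) /= addrC; congr (_ + _).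
  rewrite (eq_bigr (fun=> p)); first by rewrite sumr_const mulr_natr.
  by move=> i /cl /negPf wi; rewrite /closed_excess wi /=; ring.
have hn : h' + p * n%:R <= h.
  by rewrite hh' lerD2l ler_wpM2l // ler_nat.
have ls : s = l * (p * n%:R / 2) by rewrite /l /s; field; rewrite gt_eqF.
have [hs|hs] := leP (p * n%:R / 2) h.
  rewrite ifT; first by rewrite lerDl; case: ifP.
  by rewrite ls ler_wpM2l.
rewrite [X in _ <= _ + X]ifT; first by rewrite lerDr; case: ifP.
rewrite ls mulNr -mulrN ler_wpM2l //.
by lra.
Qed.

End Tail.

(** * Clusters in a multigraph *)

Section Reach.
Context (V E : choiceType) (G : multigraph V E).
Implicit Types (O : set E) (A B : set V) (x y z : V) (e : E).

Lemma linked_refl O x : linked G O x x.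
Proof. by exists [::]. Qed.

Lemma linked_step O x y z :
  linked G O x y -> Defs.adjacent G O y z -> linked G O x z.
Proof.
move=> [s [ps <-]] yz; exists (rcons s z); rewrite last_rcons; split => //.
by rewrite rcons_path ps; apply/asboolP.
Qed.

(** The induction principle for connectivity: a set closed under open edges
    contains the clusters of its points. *)
Lemma linked_closed O (Q : set V) x y :
  (forall a b, Q a -> Defs.adjacent G O a b -> Q b) ->
  linked G O x y -> Q x -> Q y.
Proof.
move=> cl [s [+ <-]]; elim: s x => //= a s IH x /andP[/asboolP xa ps] Qx.
by apply: IH ps _; exact: cl xa.
Qed.

Lemma linked_trans O x y z : linked G O x y -> linked G O y z -> linked G O x z.
Proof.
by move=> xy yz; apply: (@linked_closed O (linked G O x)) yz xy => a b;
  exact: linked_step.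
Qed.

Lemma adjacent_sym O x y : Defs.adjacent G O x y -> Defs.adjacent G O y x.
Proof. by move=> [e Oe [[]|[]]] h1 h2; exists e => //; [right|left]. Qed.

Lemma linked_sym O x y : linked G O x y -> linked G O y x.
Proof.
move=> xy; apply: (@linked_closed O (fun z => linked G O z x)) xy _.
  move=> a b ax ab; apply: linked_trans ax.
  by apply: linked_step (adjacent_sym ab); exact: linked_refl.
exact: linked_refl.
Qed.

(** Clusters of sets, not only of points: the clusters of the complement of a
    ball stand in for the infinite clusters. *)
Definition reach O A : set V := [set y | exists2 x, A x & linked G O x y].

Lemma reach1 O x : reach O [set x] = bond_cluster G O x.
Proof.
by apply/seteqP; split => y /=; [move=> [_ ->]|move=> xy; exists x].
Qed.

Lemma joins_touching e x y A : joins G e x y -> A x -> touching G A e.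
Proof. by move=> [[<- _]|[_ <-]] Ax; [left|right]. Qed.

(** Clusters are local: the closed edges touching a cluster certify that it does
    not extend further, and its open edges that it extends so far. This is
    what makes the edges touching it a stopping set. *)
Lemma reach_local O O' A :
    (forall e, touching G (reach O A) e -> (O e <-> O' e)) ->
  reach O' A = reach O A.
Proof.
move=> OO'; apply/seteqP; split => y [x Ax xy].
  apply: (@linked_closed O' (reach O A)) xy _; last first.
    by exists x => //; exact: linked_refl.
  move=> a b Ka [e O'e eab]; have [c Ac ca] := Ka.
  exists c => //; apply: linked_step ca _; exists e => //.
  by apply/(OO' e) => //; exact: joins_touching eab Ka.
suff : (reach O A `&` reach O' A) y by case.
apply: (@linked_closed O) xy _; last first.
  by split; exists x => //; exact: linked_refl.
move=> a b [Ka [c' Ac' ca']] [e Oe eab]; split.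
  by have [c Ac ca] := Ka; exists c => //; apply: linked_step ca _; exists e.
exists c' => //; apply: linked_step ca' _; exists e => //.
by apply/(OO' e) => //; exact: joins_touching eab Ka.
Qed.

(** Follow the path up to its first vertex outside of [B]: every edge before
    that point starts in [B]. *)
Lemma linked_exit O B x y : linked G O x y -> ~ B y ->
  exists2 z, ~ B z & linked G (O `&` touching G B) x z.
Proof.
move=> [s [+ <-]]; elim: s x => [x _|a s IH x /= /andP[/asboolP xa ps]] nBy.
  by exists x => //; exact: linked_refl.
have [Bx|nBx] := pselect (B x); last by exists x => //; exact: linked_refl.
have [z nBz az] := IH _ ps nBy; exists z => //.
apply: linked_trans az; apply: linked_step (linked_refl _ _) _.
by have [e Oe exa] := xa; exists e => //; split => //; exact: joins_touching exa Bx.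
Qed.

Fixpoint graph_ball v k : set V :=
  if k is j.+1 then
    graph_ball v j `|` [set y | exists x e, graph_ball v j x /\ joins G e x y]
  else [set v].

Lemma graph_ball_center v k : graph_ball v k v.
Proof. by elim: k => //= k IH; left. Qed.

Lemma graph_ball_mono v j k : (j <= k)%N -> graph_ball v j `<=` graph_ball v k.
Proof.
move=> /subnK <-; elim: (k - j)%N => //= i IH y /IH ?.
by left.
Qed.

Lemma finite_touching B :
  locally_finite G -> finite_set B -> finite_set (touching G B).
Proof.
move=> lf fB; apply: (@sub_finite_set _ _ (\bigcup_(x in B) touching G [set x])).
  by move=> e [Be|Be]; [exists (src G e)|exists (tgt G e)] => //; [left|right].
by apply: bigcup_finite => // x _; exact: lf.
Qed.

Lemma finite_graph_ball v k : locally_finite G -> finite_set (graph_ball v k).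
Proof.
move=> lf; elim: k => /= [|k IH]; first exact: finite_set1.
rewrite finite_setU; split=> //.
apply: (@sub_finite_set _ _
  (src G @` touching G (graph_ball v k) `|` tgt G @` touching G (graph_ball v k))).
  move=> y [x [e [Bx exy]]]; have te := joins_touching exy Bx.
  by case: exy => -[h1 h2]; [right|left]; exists e.
by rewrite finite_setU; split; apply: finite_image; exact: finite_touching.
Qed.

Lemma graph_ball_exhausts v :
  graph_connected G -> \bigcup_k graph_ball v k = setT.
Proof.
move=> conn; apply/seteqP; split => // y _.
apply: (@linked_closed setT _ v) (conn v y) _; last by exists 0%N.
by move=> a b [k _ ka] [e _ eab]; exists k.+1 => //=; right; exists a, e.
Qed.

(** If the cluster leaves the ball of radius [m], then for each [k <= m] it has
    an edge from the [k]-th ball to its complement. Such an edge lies inside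
    the next ball, so these are [m + 1] different edges. *)
Lemma small_cluster_in_ball O v m :
  touching G (bond_cluster G O v) #<= `I_m ->
  bond_cluster G O v `<=` graph_ball v m.
Proof.
move=> small; apply: contrapT => /existsNP[u /not_implyP[vu nBu]].
have crossing k : (k < m.+1)%N -> exists e, touching G (bond_cluster G O v) e /\
    exists x y, [/\ joins G e x y, graph_ball v k x & ~ graph_ball v k y].
  move=> km; apply: contrapT => none; apply: nBu; apply: (graph_ball_mono (ltnSE km)).
  suff [] : (bond_cluster G O v `&` graph_ball v k) u by [].
  apply: (@linked_closed O) vu _; last first.
    by split; [exact: linked_refl|exact: graph_ball_center].
  move=> a b [va ka] ab; split; first exact: linked_step va ab.
  have [e Oe eab] := ab; apply: contrapT => nkb; apply: none.
  by exists e; split; [exact: joins_touching eab va|exists a, b].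
have [f fP] : {f : nat -> E | forall k, (k < m.+1)%N ->
    touching G (bond_cluster G O v) (f k) /\
    exists x y, [/\ joins G (f k) x y, graph_ball v k x & ~ graph_ball v k y]}.
  have [e0 _] := cid (crossing 0%N isT).
  exists (fun k => if pselect (k < m.+1)%N is left h
                   then projT1 (cid (crossing k h)) else e0).
  by move=> k km; case: pselect => // h; case: cid.
have fneq j k : (j < k < m.+1)%N -> f j <> f k.
  move=> /andP[jk km] fjk.
  have [_ [x [y [fxy jx _]]]] := fP _ (ltn_trans jk km).
  have [_ [x' [y' [fxy' _ ky']]]] := fP _ km.
  have kx : graph_ball v k x by apply: graph_ball_mono jx; exact: ltnW.
  have ky : graph_ball v k y.
    by apply: (graph_ball_mono jk); right; exists x, (f j).
  rewrite -fjk in fxy'; apply: ky'.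
  suff : y' = x \/ y' = y by case=> ->.
  by case: fxy => -[h1 h2]; case: fxy' => -[h3 h4];
    [right|left|left|right]; congruence.
suff : `I_m.+1 #<= `I_m by rewrite card_le_II ltnn.
apply: card_le_trans small.
have finj : {in `I_m.+1 &, injective f}.
  move=> j k /set_mem /= jm /set_mem /= km fjk; apply/eqP.
  have [jk|kj|//] := ltngtP j k; exfalso.
    by apply: (fneq j k) fjk; rewrite jk.
  by apply: (fneq k j) (esym fjk); rewrite kj.
rewrite -(card_le_eql (inj_card_eq finj)); apply: subset_card_le.
by move=> _ [k km <-]; have [] := fP k km.
Qed.

End Reach.

(** * Cardinalities of sets *)

Lemma countable_seq (I : choiceType) :
  countable [set: I] -> countable [set: seq I].
Proof.
move=> /countable_injP[f finj]; apply/countable_injP.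
exists (choice.pickle \o map f) => s t _ _ /= /(pcan_inj choice.pickleK).
by apply: inj_map => x y; apply: finj; exact: mem_set.
Qed.

Lemma countable_fsets (I : choiceType) :
  countable [set: I] -> countable [set: {fset I}].
Proof.
move=> /countable_seq/countable_injP[f finj]; apply/countable_injP.
exists (fun B : {fset I} => f (enum_fset B)) => A B _ _ /= fAB; apply: val_inj.
by apply: finj fAB; exact: mem_set.
Qed.

(** Turns a cardinality bound into an existential over a countable type, hence
    into a countable union of events. *)
Lemma card_ge_fsetP (I : choiceType) (A : set I) (k : nat) :
  `I_k #<= A <-> exists B : {fset I}, [set` B] `<=` A /\ (k <= #|` B|)%N.
Proof.
split=> [kA|[B [BA kB]]]; last first.
  apply: card_le_trans (subset_card_le BA).
  have /card_eq_fsetP : #|` B| = #|` B| by [].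
  rewrite card_eq_le => /andP[_ BI].
  by apply: card_le_trans BI; rewrite card_le_II.
have [fA|iA] := pselect (finite_set A).
  exists (fset_set A); rewrite fset_setK //; split => //.
  exact: leq_card_fset_set.
by have [B] := infinite_set_fset k iA; exists B.
Qed.

Lemma infinite_card_geP (I : choiceType) (A : set I) :
  infinite_set A <-> forall k, `I_k #<= A.
Proof.
rewrite infinite_set_fsetP; split => h k.
  by have [B ? ?] := h k; apply/card_ge_fsetP; exists B.
by have /card_ge_fsetP[B [? ?]] := h k; exists B.
Qed.

Lemma card_leNge (I : choiceType) (A : set I) (m : nat) :
  A #<= `I_m <-> ~ (`I_m.+1 #<= A).
Proof.
split=> [Am /card_le_trans/(_ Am)|]; first by rewrite card_le_II ltnn.
have [/finite_setP[k Ak]|/infinite_card_geP Ainf] := pselect (finite_set A).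
  by rewrite (card_le_eqr Ak) (card_le_eql Ak) !card_le_II => /negP; rewrite -leqNgt.
by move/(_ (Ainf _)).
Qed.

Lemma card_finset (I : finType) (A : {set I}) : [set` A] #= `I_#|A|.
Proof.
have -> : [set` A] = [set enum_val i | i in [set: 'I_#|A|]].
  apply/seteqP; split => [x xA|_ [i _ <-]]; last exact: enum_valP.
  by exists (enum_rank_in xA x) => //; rewrite enum_rankK_in.
rewrite (card_eql (inj_card_eq _)); first by rewrite card_eq_sym card_II.
by move=> i j _ _; exact: enum_val_inj.
Qed.

(** * Measurability of cluster events *)

Section Measurability.
Context (d : measure_display) (T : measurableType d).

Lemma measurable_exists (I : choiceType) (D : I -> set T) :
    countable [set: I] -> (forall i, measurable (D i)) ->
  measurable [set w | exists i, D i w].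
Proof.
move=> cI mD; rewrite (_ : [set w | _] = \bigcup_i D i).
  by apply: countable_bigcupT_measurable.
by apply/seteqP; split => w [i] => [|_] Dw; exists i.
Qed.

Lemma measurable_forall (I : choiceType) (D : I -> set T) :
    countable [set: I] -> (forall i, measurable (D i)) ->
  measurable [set w | forall i, D i w].
Proof.
move=> cI mD; rewrite (_ : [set w | _] = ~` [set w | exists i, (~` D i) w]).
  by apply: measurableC; apply: measurable_exists => // i; apply: measurableC.
apply/seteqP; split => w /= h; first by move=> [i]; apply.
by move=> i; apply: contrapT => nD; apply: h; exists i.
Qed.

Lemma measurable_const (Q : Prop) : measurable [set _ : T | Q].
Proof.
have [q|nq] := pselect Q.
  by rewrite (_ : [set _ | Q] = setT) //; apply/seteqP; split.
by rewrite (_ : [set _ | Q] = set0) //; apply/seteqP; split.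
Qed.

Lemma measurable_card_ge (I : choiceType) (A : T -> set I) (k : nat) :
    countable [set: I] -> (forall i, measurable [set w | A w i]) ->
  measurable [set w | `I_k #<= A w].
Proof.
move=> cI mA.
rewrite (_ : [set w | _] = [set w | exists B : {fset I},
    ([set w | forall i, ([set _ | i \notin B] `|` [set w | A w i]) w] `&`
     [set _ | (k <= #|` B|)%N]) w]).
  apply: measurable_exists => [|B]; first exact: countable_fsets.
  apply: measurableI; last exact: measurable_const.
  apply: measurable_forall => // i; apply: measurableU => //.
  exact: measurable_const.
apply/seteqP; split => w /=; rewrite card_ge_fsetP => -[B [BA kB]];
  exists B; split => // i.
  by have [/BA|] := boolP (i \in B); [right|left].
by move=> /= iB; have [/=|//] := BA i; rewrite iB.
Qed.

Context (V E : choiceType) (G : multigraph V E) (O : T -> set E).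
Context (cV : countable [set: V]) (cE : countable [set: E]).
Context (mO : forall e, measurable [set w | O w e]).

Lemma measurable_adjacent x y : measurable [set w | Defs.adjacent G (O w) x y].
Proof.
rewrite (_ : [set w | _] =
  [set w | exists e, ([set w | O w e] `&` [set _ | joins G e x y]) w]).
  apply: measurable_exists => // e; apply: measurableI => //.
  exact: measurable_const.
by apply/seteqP; split => w [e] => [|[]] h1 h2; exists e.
Qed.

Lemma measurable_linked x y : measurable [set w | linked G (O w) x y].
Proof.
pose e w := fun a b : V => `[< Defs.adjacent G (O w) a b >].
have mpath s : measurable [set w | path (e w) x s].
  elim: s x => [|a s IH] x /=; first exact: measurable_const.
  rewrite (_ : [set w | _] =
      [set w | Defs.adjacent G (O w) x a] `&` [set w | path (e w) a s]).
    by apply: measurableI => //; exact: measurable_adjacent.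
  apply/seteqP; split => w /=; first by move=> /andP[/asboolP].
  by move=> [h1 h2]; apply/andP; split => //; apply/asboolP.
apply: (@measurable_exists _
  (fun s => [set w | path (e w) x s] `&` [set _ | last x s = y])).
  exact: countable_seq.
by move=> s; apply: measurableI => //; exact: measurable_const.
Qed.

Lemma measurable_infinite_cluster u :
  measurable [set w | infinite_set (bond_cluster G (O w) u)].
Proof.
rewrite (_ : [set w | _] =
    [set w | forall k : nat, `I_k #<= bond_cluster G (O w) u]).
  apply: measurable_forall => [|k]; first exact: countableP.
  apply: measurable_card_ge => // i.
  exact: measurable_linked.
by apply/seteqP; split => w /=; rewrite infinite_card_geP.
Qed.

Lemma measurable_mem_infinite_clusters y :
  measurable [set w | infinite_clusters G (O w) y].
Proof.
rewrite (_ : [set w | _] = [set w | exists u,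
  ([set w | infinite_set (bond_cluster G (O w) u)] `&`
   [set w | linked G (O w) u y]) w]).
  apply: measurable_exists => // u.
  by apply: measurableI; [exact: measurable_infinite_cluster|
    exact: measurable_linked].
apply/seteqP; split => w /=; first by move=> [u]; exists u.
by move=> [u []]; exists u.
Qed.

Lemma measurable_cluster_event v m n :
  measurable [set w | touching G (bond_cluster G (O w) v) #<= `I_m /\
     `I_n #<= edges_between G (bond_cluster G (O w) v)
                              (infinite_clusters G (O w))].
Proof.
have mtouch e : measurable [set w | touching G (bond_cluster G (O w) v) e].
  by apply: measurableU; exact: measurable_linked.
have mbetween e : measurable [set w |
    edges_between G (bond_cluster G (O w) v) (infinite_clusters G (O w)) e].
  rewrite (_ : [set w | _] = [set w | exists x, [set w | exists y,
     ([set w | linked G (O w) v x] `&`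
      ([set w | infinite_clusters G (O w) y] `&`
      [set _ | joins G e x y])) w] w]).
    apply: measurable_exists => // x; apply: measurable_exists => // y.
    apply: measurableI; first exact: measurable_linked.
    apply: measurableI; first exact: measurable_mem_infinite_clusters.
    exact: measurable_const.
  apply/seteqP; split => w /=; first by move=> [x [y [? ? ?]]]; exists x, y.
  by move=> [x [y [? [? ?]]]]; exists x, y; split.
rewrite (_ : [set w | _] =
   ~` [set w | `I_m.+1 #<= touching G (bond_cluster G (O w) v)] `&`
   [set w | `I_n #<= edges_between G (bond_cluster G (O w) v)
                              (infinite_clusters G (O w))]).
  apply: measurableI; last exact: measurable_card_ge.
  by apply: measurableC; exact: measurable_card_ge.
by apply/seteqP; split => w [/card_leNge ? ?].
Qed.

End Measurability.

(** * Configurations on a finite set of edges *)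

Section Config.
Context (V E : choiceType) (G : multigraph V E) (S : {fset E}).
Implicit Types (w : {ffun S -> bool}) (A : set V).

Definition opened w : set E := [set e | exists2 i : S, w i & val i = e].

Definition touched A w : {set S} :=
  finset (fun i => `[< touching G (reach G (opened w) A) (val i) >]).

Lemma in_touched A w i :
  i \in touched A w <-> touching G (reach G (opened w) A) (val i).
Proof. by rewrite finset.in_set; split => /asboolP. Qed.

Lemma card_fsval (A : {set S}) : [set val i | i in [set` A]] #= `I_#|A|.
Proof.
rewrite (card_eql (inj_card_eq _)); first exact: card_finset.
by move=> i j _ _; exact: val_inj.
Qed.

Lemma stopping_touched A : stopping (touched A).
Proof.
move=> w w' ww'; rewrite /touched (@reach_local _ _ G (opened w) (opened w')) //.
move=> e te; split => -[i wi ie]; exists i => //.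
  by rewrite -ww' //; apply/in_touched; rewrite ie.
by rewrite ww' //; apply/in_touched; rewrite ie.
Qed.

End Config.

Section Cylinders.
Context (R : realType) (E : choiceType).
Context (p : R) (p_ge0 : 0 <= p) (p_le1 : p <= 1).
Context (d : measure_display) (T : measurableType d) (P : probability T R).
Context (X : E -> {RV P >-> bool}) (X_perc : bernoulli_percolation p X).
Context (S : {fset E}).
Implicit Types (w : {ffun S -> bool}).

Definition config (t : T) : {ffun S -> bool} := [ffun i => X (val i) t].

Lemma opened_config t : opened (config t) = open_edges X t `&` [set` S].
Proof.
apply/seteqP; split => e /=.
  by move=> [i + <-]; rewrite ffunE => Xi; split => //; exact: valP.
by move=> [Xe eS]; exists [` eS]%fset => //; rewrite ffunE.
Qed.

Lemma measurable_open e : measurable [set t | open_edges X t e].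
Proof. exact: (measurable_funPTI (X e) (Y := [set true])). Qed.

Lemma measurable_cylinder w : measurable [set t | config t = w].
Proof.
rewrite (_ : [set t | _] = [set t | forall i : S, X (val i) t = w i]).
  apply: measurable_forall => [|i]; first exact: countableP.
  exact: (measurable_funPTI (X (val i)) (Y := [set w i])).
apply/seteqP; split => t /=; first by move=> <- i; rewrite ffunE.
by move=> h; apply/ffunP => i; rewrite ffunE; exact: h.
Qed.

(** Joint independence applied to the edges of [S] only; [B] extends the pattern
    [w] to all edges, as independence is stated for families indexed by [E]. *)
Lemma cylinder_prob w : P [set t | config t = w] = (config_weight p w)%:E.
Proof.
have [indep bern] := X_perc.
pose B (e : E) : set bool := [set b | forall i : S, val i = e -> b = w i].
rewrite (_ : [set t | _] = \bigcap_(e in [set` S]) (X e @^-1` B e)); last first.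
  apply/seteqP; split => t /=.
    by move=> cw e eS i <-; rewrite -cw ffunE.
  move=> h; apply/ffunP => i; rewrite ffunE.
  by apply: (h (val i)) => //=; exact: valP.
rewrite indep big_seq_fsetE /= /config_weight -prodEFin.
apply: eq_bigr => i _.
have -> : B (val i) = [set w i].
  apply/seteqP; split => b /=; first by apply.
  by move=> -> j /val_inj ->.
transitivity (distribution P (X (val i)) [set w i]); first by [].
rewrite bern /bernoulli_prob ifT ?p_ge0 // fsbig_set1.
by [].
Qed.

Lemma config_union_bound (A : set T) (bad : pred {ffun S -> bool}) :
    measurable A -> (forall t, A t -> bad (config t)) ->
  (P A <= (\sum_(w | bad w) config_weight p w)%:E)%E.
Proof.
move=> mA Abad.
rewrite -sumEFin (eq_bigr (fun w => P [set t | config t = w])); last first.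
  by move=> w _; rewrite cylinder_prob.
rewrite bigfs ?index_enum_uniq //; last by move=> w _; rewrite mem_index_enum.
apply: content_sub_fsum => //.
  by move=> w _; exact: measurable_cylinder.
by move=> t /Abad bt; exists (config t).
Qed.

End Cylinders.

(** * The bound on the edges between a finite cluster and the infinite ones *)

Theorem proposition2p4 (R : realType) (V E : choiceType) (G : multigraph V E)
  (G_connected : graph_connected G) (G_locally_finite : locally_finite G)
  (p : R) (p_gt0 : 0 < p) (p_lt1 : p < 1)
  (d : measure_display) (T : measurableType d) (P : probability T R)
  (X : E -> {RV P >-> bool}) (X_perc : bernoulli_percolation p X)
  (v : V) (n m : nat) (n_ge1 : (1 <= n)%N) (m_ge1 : (1 <= m)%N) :
  (P [set w | let K_v := bond_cluster G (open_edges X w) v in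
              let K_oo := infinite_clusters G (open_edges X w) in
              touching G K_v #<= `I_m /\ `I_n #<= edges_between G K_v K_oo]
   <= (2 * expR (- (p ^+ 2 * n%:R ^+ 2 / (8 * m%:R))))%:E)%E.
Proof.
have cV : countable [set: V].
  rewrite -(graph_ball_exhausts v G_connected); apply: bigcup_countable => // k _.
  by apply: finite_set_countable; exact: finite_graph_ball.
have cE : countable [set: E].
  rewrite (_ : setT = \bigcup_x touching G [set x]).
    apply: bigcup_countable => // x _; apply: finite_set_countable.
    exact: G_locally_finite.
  by apply/seteqP; split => // e _; exists (src G e) => //; left.
set A := [set w | _].
have mA : measurable A.
  by apply: measurable_cluster_event => // e; exact: measurable_open.
have [nm|mn] := leqP n m; last first.
  rewrite (_ : A = set0) ?measure0 ?lee_fin ?mulr_ge0 ?expR_ge0 //.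
  (* Every edge between [K_v] and [K_oo] touches [K_v]. *)
  apply/seteqP; split => // w [small many].
  suff : `I_n #<= `I_m by rewrite card_le_II leqNgt mn.
  apply: card_le_trans small; apply: card_le_trans many (subset_card_le _).
  by move=> e [x [y [Kx _ exy]]]; exact: joins_touching exy Kx.
pose B := graph_ball G v m.
have fS : finite_set (touching G B).
  by apply: finite_touching => //; exact: finite_graph_ball.
pose S := fset_set (touching G B).
have SE : [set` S] = touching G B by exact: fset_setK.
pose D := @touched V E G S [set v].
have bound := common_closed_edges_bound (ltW p_gt0) (ltW p_lt1)
  (@stopping_touched V E G S [set v]) (@stopping_touched V E G S (~` B)) nm m_ge1.
apply: le_trans (config_union_bound (ltW p_gt0) (ltW p_lt1) X_perc mA _) _;
  last by rewrite lee_fin; exact: bound.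
move=> t [small many].
set O := open_edges X t in small many.
have KB : bond_cluster G O v `<=` B by exact: small_cluster_in_ball.
have tKB : touching G (bond_cluster G O v) `<=` [set` S].
  by rewrite SE => e [/KB|/KB]; [left|right].
(* On the event, closing all the edges outside of [S] does not affect [K_v]. *)
have Kv : reach G (opened (config X S t)) [set v] = bond_cluster G O v.
  rewrite -reach1; apply: reach_local => e; rewrite reach1 => te.
  rewrite opened_config; split => [Oe|[]//]; split => //; exact: tKB.
have DE : [set val i | i in [set` D (config X S t)]] =
    touching G (bond_cluster G O v).
  apply/seteqP; split => e /=.
    by move=> [i /in_touched + <-]; rewrite Kv.
  move=> te; exists [` tKB e te]%fset => //.
  by apply/in_touched; rewrite Kv.
(* Hence [K_v] cannot be joined inside [S] to the complement of [B]. *)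
have oB x y : linked G (opened (config X S t)) x y ->
    bond_cluster G O v x -> B y.
  move=> xy vx; apply: KB; move: vx; rewrite -Kv => -[_ -> vx].
  by exists v => //; apply: linked_trans xy.
apply/and3P; split.
- by rewrite -card_le_II -(card_le_eql (card_fsval _)) DE.
- rewrite -card_le_II -(card_le_eqr (card_fsval _)).
  apply: card_le_trans many (subset_card_le _) => e [x [y [vx [u uinf uy] exy]]].
  have : touching G (bond_cluster G O v) e by exact: joins_touching exy vx.
  rewrite -DE => -[i iD ie]; exists i => //=; rewrite finset.in_setI.
  apply/andP; split => //; apply/in_touched; rewrite ie.
  (* The cluster of [y] is infinite, so it leaves [B]. *)
  have [z uz nBz] : exists2 z, bond_cluster G O u z & ~ B z.
    apply: contrapT => none; apply: uinf.
    apply: (@sub_finite_set _ _ B); last exact: finite_graph_ball.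
    by move=> z uz; apply: contrapT => nBz; apply: none; exists z.
  have [z' nBz' yz'] := linked_exit (linked_trans (linked_sym uy) uz) nBz.
  have Ky : reach G (opened (config X S t)) (~` B) y.
    by exists z' => //; apply: linked_sym; rewrite opened_config SE.
  by apply: (joins_touching (y := x) _ Ky); case: exy => -[? ?]; [right|left].
- apply/forall_inP => i; rewrite finset.in_setI => /andP[/in_touched].
  rewrite Kv => vi /in_touched oi; apply/negP => wi.
  (* If the edge were open, then both of its ends would belong to [K_v]. *)
  have ends x y : joins G (val i) x y -> bond_cluster G O v x ->
      bond_cluster G O v y.
    move=> ixy; rewrite -Kv => -[_ -> vx]; exists v => //.
    by apply: linked_step vx _; exists (val i) => //; exists i.
  have [vs vt] : bond_cluster G O v (src G (val i)) /\
                 bond_cluster G O v (tgt G (val i)).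
    by case: vi => vi; split => //; apply: ends vi; [left|right].
  by case: oi => -[z nBz zi]; apply: nBz; apply: oB (linked_sym zi) _.
Qed.
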